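(* Let $A$ be a Noetherian (commutative) ring and $M$ a non-zero $A$-module (not necessarily finitely generated). Let $<$ be a well-ordering on the set $\mathrm{Ass}(\widetilde{M})$ which extends the partial order $\prec$ on $\mathrm{Ass}(\widetilde M)$ (recalled in the context). Then there exists a unique family $(M^t)_{t\in \mathrm{Ass}(\widetilde{M})}$ of $A$-submodules of $M$ satisfying the following properties: (a) $M^r\supset M^s$ if $r<s$; (b) $M^0=M$, where $0$ denotes the minimal element of $(\mathrm{Ass}(\widetilde M),<)$; (c) $\mathrm{Ass}(\widetilde{M^t/M^{t+1}})=\{t\}$ for every $t\in\mathrm{Ass}(\widetilde M)$ that is not the maximal element, where $t+1$ is the immediate successor of $t$; (d) if $t$ is a limit point of $(\mathrm{Ass}(\widetilde M),<)$, then $M^t=\bigcap_{r<t} M^r$; (e) $\mathrm{Ass}(\widetilde{M^t})=\{r\in \mathrm{Ass}(\widetilde M): r\geqslant t\}$ for every $t\in\mathrm{Ass}(\widetilde M)$.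
   Context: For an $A$-module $N$, $\widetilde N$ is the associated quasi-coherent sheaf on $\mathrm{Spec}(A)$. For a quasi-coherent sheaf $\mathcal F$ on a locally Noetherian scheme $X$, $\mathrm{Ass}(\mathcal F)$ is the set of points $x\in X$ such that there is $s_x\in\mathcal F_x$ with $\mathrm{ann}(s_x)=\mathfrak m_x$, the maximal ideal of $\mathcal O_{X,x}$. (For $\mathcal F=\widetilde N$ over a Noetherian ring these are the primes $\mathfrak p$ of the form $\mathrm{ann}(m)$, $m\in N$.) The partial order $\prec$ on $\mathrm{Ass}(\widetilde M)\subseteq \mathrm{Spec}(A)$ is: $\mathfrak q\prec\mathfrak p$ iff $\overline{\{\mathfrak p\}}\subsetneq\overline{\{\mathfrak q\}}$ (i.e. $\mathfrak q\subsetneq\mathfrak p$). A well-ordering $<$ extends $\prec$ if $\mathfrak q\prec\mathfrak p$ implies $\mathfrak q<\mathfrak p$. The symbol $\supset$ denotes proper inclusion. An element $t$ of a well-ordered set is a limit point if there is some $x<t$ and for every $x<t$ there is $y$ with $x<y<t$. *)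

(* Defs.v *)
From HB Require Import structures.
From mathcomp Require Import all_boot all_order all_algebra.
From mathcomp Require Import ring_quotient generic_quotient.
From mathcomp Require Import boolp classical_sets wochoice.

Set Implicit Arguments.
Unset Strict Implicit.
Unset Printing Implicit Defensive.

Import GRing.Theory.
Local Open Scope ring_scope.
Local Open Scope quotient_scope.
Local Open Scope classical_set_scope.

(* Submodules of an A-module M are the predicates of type submodClosed M.
   Ideals of A, improper ones included, are the submodules of A^o. *)
Definition noetherian (A : comNzRingType) : Prop :=
  forall I : submodClosed A^o, exists (n : nat) (g : 'I_n -> A),
    forall x : A, x \in I <-> exists c : 'I_n -> A, x = \sum_(i < n) c i * g i.

Section Submodule.
Context (A : pzRingType) (M : lmodType A) (N : submodClosed M).

Record submod_type := SubmodElt { submod_val : M; _ : submod_val \in N }.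

HB.instance Definition _ := [isSub for submod_val].
HB.instance Definition _ := [Choice of submod_type by <:].
HB.instance Definition _ := [SubChoice_isSubLmodule of submod_type by <:].

End Submodule.

(* N `&` L seen as a submodule of the module N. *)
Section SubmoduleInSubmodule.
Context (A : pzRingType) (M : lmodType A) (N L : submodClosed M).

Definition submod_in : {pred submod_type N} := fun x => submod_val x \in L.

Fact submod_in_closed : submod_closed submod_in.
Proof.
split=> [|a x y Lx Ly]; first exact: (rpred0 L).
by apply: (rpredD (S := L)) => //; apply: (rpredZ (s := L)).
Qed.
HB.instance Definition _ :=
  GRing.isSubmodClosed.Build A (submod_type N) submod_in submod_in_closed.

End SubmoduleInSubmodule.

Arguments submod_in {A M} N L _.

Section QuotientModule.
Context (A : pzRingType) (V : lmodType A) (L : submodClosed V).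

(* The library quotients zmodules by a zmodClosed predicate. *)
Definition submod_zmod : {pred V} := fun x => x \in L.

Fact submod_zmod_closed : zmod_closed submod_zmod.
Proof.
split=> [|x y Lx Ly]; first exact: (rpred0 L).
rewrite -scaleN1r.
by apply: (rpredD (S := L)) => //; apply: (rpredZ (s := L)).
Qed.
HB.instance Definition _ := GRing.isZmodClosed.Build V submod_zmod
  submod_zmod_closed.

Definition quotmod : Type := Quotient.quot (submod_zmod : zmodClosed V).
HB.instance Definition _ := GRing.Zmodule.on quotmod.
HB.instance Definition _ := EqQuotient.on quotmod.

Definition quot_scale (a : A) (x : quotmod) : quotmod :=
  \pi_quotmod (a *: repr x).

Fact pi_quot_scale a v : quot_scale a (\pi_quotmod v) = \pi_quotmod (a *: v).
Proof.
apply/eqP; rewrite -[_ == _]Quotient.idealrBE -scalerBr.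
apply: (rpredZ (s := L)).
change (repr (\pi_quotmod v) - v \in (submod_zmod : zmodClosed V)).
by rewrite Quotient.idealrBE reprK.
Qed.

Fact quot_scalerA a b x : quot_scale a (quot_scale b x) = quot_scale (a * b) x.
Proof. by elim/quotW: x => v; rewrite !(pi_quot_scale _ v) pi_quot_scale scalerA. Qed.

Fact quot_scale1r : left_id 1 quot_scale.
Proof. by elim/quotW => v; rewrite pi_quot_scale scale1r. Qed.

Let pi_quotD u v : \pi_quotmod (u + v) = \pi_quotmod u + \pi_quotmod v.
Proof. exact: (@pi_addr _ _ _ _ _ (Quotient.quot submod_zmod)). Qed.

Fact quot_scalerDr : right_distributive quot_scale +%R.
Proof.
move=> a; elim/quotW => u; elim/quotW => v.
by rewrite (pi_quot_scale a u) (pi_quot_scale a v) -!pi_quotD pi_quot_scale scalerDr.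
Qed.

Fact quot_scalerDl x : {morph quot_scale^~ x : a b / a + b}.
Proof.
by move=> a b; elim/quotW: x => v; rewrite !(pi_quot_scale _ v) -pi_quotD scalerDl.
Qed.

HB.instance Definition _ := GRing.Zmodule_isLmodule.Build A quotmod
  quot_scalerA quot_scale1r quot_scalerDr quot_scalerDl.

End QuotientModule.

Section Localization.
Context (A : comNzRingType) (p : prime_idealr A).

Record denom := Denom { denom_val : A; denomP : denom_val \notin p }.

Fact denom_mul_subproof (s t : denom) : denom_val s * denom_val t \notin p.
Proof. by rewrite prime_idealrM negb_or !denomP. Qed.
Definition denom_mul s t := Denom (denom_mul_subproof s t).

Fact denom_one_subproof : 1 \notin p.
Proof. by rewrite idealr1. Qed.
Definition denom_one := Denom denom_one_subproof.

(* The pair (n, s) stands for the element n / s of the localization N_p, which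
   is the stalk of the sheaf associated with N at the point p of Spec A.
   Elements of N_p are fractions up to frac_eq; the local ring A_p is the case
   N = A^o. *)
Definition frac (N : lmodType A) : Type := (N * denom)%type.

Definition frac_eq (N : lmodType A) (x y : frac N) : Prop :=
  exists u : denom,
    denom_val u *: (denom_val y.2 *: x.1 - denom_val x.2 *: y.1) = 0.

Definition frac_scale (N : lmodType A) (a : frac A^o) (x : frac N) : frac N :=
  ((a.1 : A) *: x.1, denom_mul a.2 x.2).

Definition frac_ann (N : lmodType A) (x : frac N) : set (frac A^o) :=
  [set a | frac_eq (frac_scale a x) (0, denom_one)].

(* The maximal ideal p A_p of A_p. *)
Definition frac_max : set (frac A^o) :=
  [set a | exists b : frac A^o, (b.1 : A) \in p /\ frac_eq a b].

End Localization.

Arguments frac_max {A} p _.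

Definition Ass (A : comNzRingType) (N : lmodType A) : set (prime_idealr A) :=
  [set p | exists x : frac p N, frac_ann x = frac_max p].

Section Spec.
Context (A : comNzRingType).

Definition zero_locus (E : set A) : set (prime_idealr A) :=
  [set q | forall a, E a -> a \in q].

Definition zariski_closure (Y : set (prime_idealr A)) : set (prime_idealr A) :=
  \bigcap_(E in [set E | Y `<=` zero_locus E]) zero_locus E.

Definition spec_prec (q p : prime_idealr A) : Prop :=
  zariski_closure [set p] `<` zariski_closure [set q].

End Spec.

(* As in wochoice, R is the reflexive order relation. *)
Section WellOrder.
Context (T : Type) (R : rel T).

Definition strict (x y : T) : Prop := R x y /\ x <> y.

Definition is_least (x : T) : Prop := forall y, R x y.

Definition is_succ (x y : T) : Prop :=
  strict x y /\ forall z, strict x z -> R y z.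

Definition limit_point (t : T) : Prop :=
  (exists x, strict x t) /\
  (forall x, strict x t -> exists y, strict x y /\ strict y t).

End WellOrder.

(* Main.v *)
Require Import Defs.
From HB Require Import structures.
From mathcomp Require Import all_boot all_order all_algebra.
From mathcomp Require Import ring_quotient generic_quotient.
From mathcomp Require Import boolp classical_sets wochoice.

Set Implicit Arguments.
Unset Strict Implicit.
Unset Printing Implicit Defensive.

Import GRing.Theory.
Local Open Scope ring_scope.
Local Open Scope classical_set_scope.

(** Write K_q for the kernel of the localization map M -> M_q. The filtration
    is forced to be M^t = the intersection of the K_q for q < t, that is, the
    elements of M whose support avoids every associated prime before t.

    Existence rests on one observation ([ann_tail]): if ann x is an associated
    prime r, then x lies in K_q exactly when r is not contained in q. Since the
    well-order extends inclusion of primes, such an x lies in M^t exactly when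
    t <= r, which gives the associated primes of M^t. Passing from t to its
    successor t' only adds the condition x \in K_t, so M^t / M^t' embeds into
    M_t; its associated primes are therefore contained in t, and, once
    denominators are cleared, they are also associated primes of M^t, hence
    >= t. Only t is left,
    and t does occur: if ann x = t, then t is also the annihilator of x modulo
    M^t'.

    Uniqueness is proved by two inclusions. If a submodule N has no associated
    prime before t, then an element of N that survives in M_q, with q < t, has
    a multiple annihilated by exactly a prime p contained in q ([ann_below]),
    and p <= q < t is absurd; hence N is contained in M^t ([sub_tail]). The
    converse inclusion goes by transfinite induction on t ([tail_sub]); its
    only substantial case is a successor, where an element of M^t' outside F t'
    would produce an associated prime of F t / F t', that is t, containing a
    denominator outside t.

    The Noetherian hypothesis enters twice: an element outside a submodule has
    a multiple whose colon ideal is prime ([prime_colon]), and, as ideals are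
    finitely generated, one denominator serves for a whole ideal
    ([clear_denominators]). *)

(** * Extensionality of bundled primes and submodules *)

Lemma prime_idealr_inj (A : comNzRingType) (p q : prime_idealr A) :
  p =i q -> p = q.
Proof.
case: p q => [P cP] [Q cQ] /= eqPQ.
have {}eqPQ : P = Q by apply/funext=> a; exact: eqPQ.
rewrite -{}eqPQ in cQ *; congr PrimeIdealr.Pack.
case: cP cQ => [[a] [b] [c] [d]] [[a'] [b'] [c'] [d']].
by rewrite (Prop_irrelevance a a') (Prop_irrelevance b b')
  (Prop_irrelevance c c') (Prop_irrelevance d d').
Qed.

Lemma submodClosed_inj (A : pzRingType) (M : lmodType A) (N L : submodClosed M) :
  N =i L -> N = L.
Proof.
case: N L => [P cP] [Q cQ] /= eqPQ.
have {}eqPQ : P = Q by apply/funext=> a; exact: eqPQ.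
rewrite -{}eqPQ in cQ *; congr GRing.SubmodClosed.Pack.
case: cP cQ => [[a] [b]] [[a'] [b']].
by rewrite (Prop_irrelevance a a') (Prop_irrelevance b b').
Qed.

(** * Colon ideals, localization kernels and the zero submodule *)

Section Colon.
Context (A : comNzRingType) (M : lmodType A).

Definition colon (T : submodClosed M) (x : M) : {pred A^o} :=
  fun a => (a : A) *: x \in T.

Fact colon_closed T x : submod_closed (colon T x).
Proof.
split=> [|a u v Tu Tv]; first by rewrite unfold_in scale0r (rpred0 T).
rewrite unfold_in scalerDl -scalerA (rpredD (S := T)) //.
exact: (rpredZ (s := T)).
Qed.
HB.instance Definition _ T x :=
  GRing.isSubmodClosed.Build A A^o (colon T x) (colon_closed T x).

Lemma colonE T x a : (a \in colon T x) = (a *: x \in T).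
Proof. by []. Qed.

(** The kernel of the localization map M -> M_q. *)
Definition local_kernel (q : prime_idealr A) : {pred M} :=
  fun x => `[< exists2 w, w \notin q & w *: x = 0 >].

Lemma local_kernelP (q : prime_idealr A) (x : M) :
  reflect (exists2 w, w \notin q & w *: x = 0) (x \in local_kernel q).
Proof. exact: asboolP. Qed.

Fact local_kernel_closed q : submod_closed (local_kernel q).
Proof.
split=> [|a x y]; first by apply/asboolP; exists 1; rewrite ?idealr1 ?scaler0.
move=> /asboolP[u qu ux] /asboolP[v qv vy]; apply/asboolP; exists (u * v).
  by rewrite prime_idealrM negb_or qu.
by rewrite scalerDr -[in X in _ + X]scalerA vy scaler0 addr0 scalerA
  -mulrA mulrC -scalerA ux scaler0.
Qed.
HB.instance Definition _ q :=
  GRing.isSubmodClosed.Build A M (local_kernel q) (local_kernel_closed q).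

End Colon.

Arguments local_kernel {A} M q _.

Section ZeroSubmodule.
Context (A : pzRingType) (M : lmodType A).

Definition zero_submod : {pred M} := pred1 0.

Fact zero_submod_closed : submod_closed zero_submod.
Proof.
split=> [|a x y /eqP-> /eqP->]; first exact: eqxx.
by rewrite scaler0 addr0; apply: eqxx.
Qed.
HB.instance Definition _ :=
  GRing.isSubmodClosed.Build A M zero_submod zero_submod_closed.

End ZeroSubmodule.

Arguments zero_submod {A} M _.

(** * Consequences of the Noetherian hypothesis *)

Section Noetherian.
Context (A : comNzRingType).

(** [noetherian] speaks of submodules of A^o, whereas primes are bundled as
    [idealr]s. *)
Definition ideal_submod (p : idealr A) : {pred A^o} := fun a => (a : A) \in p.
Fact ideal_submod_closed p : submod_closed (ideal_submod p).
Proof.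
split=> [|a u v pu pv]; first exact: (rpred0 p).
by apply: (rpredD (S := p)) => //; apply: idealMr.
Qed.
HB.instance Definition _ p :=
  GRing.isSubmodClosed.Build A A^o (ideal_submod p) (ideal_submod_closed p).

(** Finite generation, phrased as the minimality of the ideal among those that
    contain the generators, which is how it is used: a property of all
    elements of I need only be tested on a finite sequence. *)
Lemma noetherian_generators (I : submodClosed A^o) : noetherian A ->
  exists2 s : seq A, {subset s <= (I : {pred A})} &
    forall J : submodClosed A^o, {subset s <= (J : {pred A})} ->
      {subset I <= J}.
Proof.
move=> /(_ I) [n [g gP]]; exists (codom g).
  move=> _ /codomP[i ->]; apply/gP; exists (fun j => (j == i)%:R).
  by rewrite (bigD1 i) //= eqxx mul1r big1 ?addr0 // => j /negPf->; rewrite mul0r.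
move=> J sJ a /gP[c ->]; apply: (rpred_sum (S := J)) => i _.
by apply: (rpredZ (s := J)); apply/sJ/codom_f.
Qed.

(** The ascending chain condition: the union of a chain of ideals is an ideal,
    and its finitely many generators already lie in one member of the chain.
    The family is indexed so that Zorn's lemma can be run on the indices. *)
Lemma noetherian_chain (T : Type) (I : T -> submodClosed A^o) (C : set T) :
  noetherian A -> C !=set0 ->
  (forall s t, C s -> C t -> {subset I s <= I t} \/ {subset I t <= I s}) ->
  exists2 t, C t & forall s, C s -> {subset I s <= I t}.
Proof.
move=> nA [t0 Ct0] tot.
have bnd (s : seq A) : (forall a, a \in s -> exists2 t, C t & a \in I t) ->
    exists2 t, C t & {subset s <= (I t : {pred A})}.
  elim: s => [|a s IHs] sC; first by exists t0.
  have [|t Ct st] := IHs; first by move=> b bs; apply: sC; rewrite inE bs orbT.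
  have [|t' Ct' at'] := sC a; first exact: mem_head.
  have [tt'|t't] := tot _ _ Ct Ct'.
    by exists t' => // b /predU1P[->//|/st/tt'].
  by exists t => // b /predU1P[->|/st//]; apply: t't.
pose U : {pred A^o} := fun a => `[< exists2 t, C t & a \in I t >].
have clU : submod_closed U.
  split=> [|a u v]; first by apply/asboolP; exists t0; rewrite ?(rpred0 (I t0)).
  move=> /asboolP[t Ct It] /asboolP[t' Ct' It']; apply/asboolP.
  have [tt'|t't] := tot _ _ Ct Ct'; [exists t'|exists t] => //.
    by apply: (rpredD (S := I t')) => //; apply/(rpredZ (s := I t'))/tt'.
  by apply: (rpredD (S := I t)); [apply: (rpredZ (s := I t))|apply: t't].
pose clUi := GRing.isSubmodClosed.Build A A^o U clU.
pose U' : submodClosed A^o := HB.pack U clUi.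
have [s sU Us] := noetherian_generators U' nA.
have [t Ct st] : exists2 t, C t & {subset s <= (I t : {pred A})}.
  by apply: bnd => a /sU/asboolP.
by exists t => // t' Ct' a at'; apply: Us => //; apply/asboolP; exists t'.
Qed.

End Noetherian.

(** * Annihilators and associated primes *)

Section Prime.
Context (A : comNzRingType) (M : lmodType A).
Hypothesis nA : noetherian A.

(** Among the ideals (T : a x) with a x outside T, one that is maximal is
    prime: if u v lies in it and u does not, then (T : u a x) is another such
    ideal, which contains it and v. *)
Lemma prime_colon (T : submodClosed M) (x : M) : x \notin T ->
  exists a : A, exists p : prime_idealr A, p =i colon T (a *: x).
Proof.
move=> xT; pose X := {a : A | a *: x \notin T}.
have oX : 1 *: x \notin T by rewrite scale1r.
pose I (t : X) := colon T (val t *: x) : submodClosed A^o.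
(* Distinct multipliers may give the same ideal, hence Zorn for a preorder. *)
have [|||t tmax] := @ZL_preorder X (Sub 1 oX)
    (fun s t => `[< {subset I s <= I t} >]).
- by move=> t; apply/asboolP.
- by move=> r s t /asboolP rs /asboolP st; apply/asboolP => a /rs/st.
- move=> C totC; have [->|/set0P neC] := eqVneq C set0; first by exists (Sub 1 oX).
  have [|t _ tP] := @noetherian_chain A X I C nA neC.
    by move=> s t /totC sC /sC[] /asboolP; [left|right].
  by exists t => s /tP ?; apply/asboolP.
pose P : {pred A} := colon T (val t *: x).
have clP : idealr_closed P.
  split; first by rewrite /P colonE scale0r (rpred0 T).
    by rewrite /P colonE scale1r (valP t).
  move=> a u v Pu Pv; apply: (rpredD (S := I t)) => //.
  exact: (rpredZ (s := I t)).
have prP : prime_idealr_closed P.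
  move=> u v; rewrite /P !colonE => uvT; apply: contraT.
  rewrite negb_or => /andP[uT vT].
  have uX : (u * val t) *: x \notin T by rewrite -scalerA.
  have le_t : {subset I t <= I (Sub (u * val t) uX)}.
    move=> b bT; rewrite colonE /= scalerA mulrCA -!scalerA.
    exact: (rpredZ (s := T)).
  have /asboolP ge_t := tmax (Sub (u * val t) uX) (introT (asboolP _) le_t).
  have /ge_t : v \in I (Sub (u * val t) uX).
    by rewrite colonE /= scalerA mulrA (mulrC v) -scalerA.
  by rewrite colonE (negPf vT).
pose i1 := isIdealr.Build A P clP.
pose i2 := isPrimeIdealrClosed.Build A P prP.
pose p : prime_idealr A := HB.pack P i1 i2.
by exists (val t), p.
Qed.

(** A denominator that works for each of finitely many generators of I can be
    found by taking a product. *)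
Lemma clear_denominators (q : prime_idealr A) (I : submodClosed A^o) (x : M) :
  (forall a : A, a \in I -> a *: x \in local_kernel M q) ->
  exists2 w, w \notin q & forall a : A, a \in I -> a *: (w *: x) = 0.
Proof.
have [s sI Is] := noetherian_generators I nA => Ix.
have [w qw sw] : exists2 w, w \notin q & forall a, a \in s -> w *: (a *: x) = 0.
  have {sI Is Ix}: forall a, a \in s -> a *: x \in local_kernel M q.
    by move=> a /sI/Ix.
  elim: s => [_|a s IHs sx]; first by exists 1; rewrite ?idealr1.
  have [b bs|w qw sw] := IHs; first by apply: sx; rewrite inE bs orbT.
  have /local_kernelP[v qv vx] := sx a (mem_head _ _).
  exists (v * w) => [|b]; first by rewrite prime_idealrM negb_or qv.
  case/predU1P=> [->|bs]; first by rewrite mulrC -scalerA vx scaler0.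
  by rewrite -scalerA sw ?scaler0.
exists w => // a aI.
suff: a \in colon (zero_submod M) (w *: x) by move/eqP.
apply: Is aI => b bs; rewrite colonE scalerA mulrC -scalerA sw //.
exact: (rpred0 (zero_submod M)).
Qed.

(** A prime that is the annihilator of the image of x in M_q is the annihilator
    of a multiple of x in M itself, so associated primes of the localization
    are associated primes of M. *)
Lemma lift_local_ann (p q : prime_idealr A) (x : M) :
  (forall b, b \in p <-> b *: x \in local_kernel M q) ->
  exists2 w, w \notin q & forall b, (b \in p) = (b *: (w *: x) == 0).
Proof.
move=> px; have [w qw wx] := @clear_denominators q (ideal_submod p) x
  (fun a pa => (px a).1 pa).
exists w => // b; apply/idP/eqP => [/wx//|bwx].
apply/px/local_kernelP; exists w => //.
by rewrite scalerA mulrC -scalerA.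
Qed.

(** A prime containing a denominator outside q would kill the image in M_q of
    an element that is nonzero there; hence p is contained in q. *)
Lemma ann_local_subset (p q : prime_idealr A) (x : M) :
  (forall b, b \in p <-> b *: x \in local_kernel M q) -> {subset p <= q}.
Proof.
move=> px b /px/local_kernelP[v qv vbx]; apply: contraFT (idealr1 p) => qb.
apply/px/local_kernelP; exists (v * b); last by rewrite scale1r -scalerA.
by rewrite prime_idealrM negb_or qv.
Qed.

(** The image of x in the module M_q is nonzero, so some multiple of it has a
    prime annihilator: apply [prime_colon] to the kernel of M -> M_q, then lift
    the prime to M. *)
Lemma ann_below (q : prime_idealr A) (x : M) : x \notin local_kernel M q ->
  exists a : A, exists2 p : prime_idealr A,
    {subset p <= q} & forall b, (b \in p) = (b *: (a *: x) == 0).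
Proof.
move=> /prime_colon[a [p pP]].
have px b : b \in p <-> b *: (a *: x) \in local_kernel M q by rewrite pP.
have [w _ wP] := lift_local_ann px.
by exists (w * a), p => [|b]; [apply: ann_local_subset px|rewrite -scalerA].
Qed.

(** Membership in [Ass] is defined in the localization at p; over a Noetherian
    ring it can be witnessed globally. *)
Lemma AssP (p : prime_idealr A) :
  Ass M p <-> exists x : M, forall b, (b \in p) = (b *: x == 0).
Proof.
have maxE (a : A) (s : denom p) : frac_max p ((a, s) : Defs.frac p A^o) <-> a \in p.
  split=> [[[b t] /= [pb [u /=]]]|pa]; last first.
    by exists (a, s); split=> //; exists s; rewrite subrr scaler0.
  (* In A^o, scaling is multiplication. *)
  move/eqP; rewrite -[_ *: _]/(denom_val u * _) => /eqP eq0.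
  have : denom_val u * (denom_val t * a - denom_val s * b) \in p.
    by rewrite eq0; apply: idealr0.
  rewrite prime_idealrM (negPf (denomP u)) /= => pd.
  have : denom_val t * a \in p.
    rewrite -(subrK (denom_val s * b) (denom_val t * a)).
    by rewrite (rpredD (S := p)) // idealMr.
  by rewrite prime_idealrM (negPf (denomP t)).
have annE (a : A) (s : denom p) (x : Defs.frac p M) :
    frac_ann x ((a, s) : Defs.frac p A^o) <-> a *: x.1 \in local_kernel M p.
  split=> [[u /=]|/local_kernelP[w pw wx]].
    rewrite scaler0 subr0 scale1r => ux; apply/local_kernelP.
    by exists (denom_val u) => //; apply: denomP.
  by exists (Denom pw); rewrite /= scaler0 subr0 scale1r.
split=> [[x xP]|[x xP]].
  have px a : a \in p <-> a *: x.1 \in local_kernel M p.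
    by rewrite -(maxE a (denom_one p)) -xP annE.
  by have [w _ wP] := lift_local_ann px; exists (w *: x.1).
exists (x, denom_one p); apply/seteqP; split=> -[a s] /=.
  move=> /annE /local_kernelP[w pw /eqP]; rewrite scalerA -xP prime_idealrM.
  by rewrite (negPf pw) => /maxE.
move=> /maxE pa; apply/annE/local_kernelP; exists 1; rewrite ?idealr1 //.
by apply/eqP; rewrite scale1r -xP.
Qed.

End Prime.

(** The two instances of [AssP] that the theorem refers to, with submodules and
    quotients of submodules of M read inside M. *)
Section Sub.
Context (A : comNzRingType) (M : lmodType A) (N L : submodClosed M).
Hypothesis nA : noetherian A.

Lemma Ass_submodP p : Ass (submod_type N) p <->
  exists2 x : M, x \in N & forall b, (b \in p) = (b *: x == 0).
Proof.
rewrite AssP //; split=> [[[x Nx] xP]|[x Nx xP]].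
  by exists x => // b; rewrite xP -val_eqE.
by exists (SubmodElt Nx) => b; rewrite xP -val_eqE.
Qed.

Lemma Ass_quotP p : Ass (quotmod (submod_in N L)) p <->
  exists2 x : M, x \in N & forall b, (b \in p) = (b *: x \in L).
Proof.
have piE (b : A) (x : submod_type N) :
    (b *: (\pi_(quotmod (submod_in N L)) x)%qT == 0) = (b *: val x \in L).
  rewrite -[b *: _]/(quot_scale _ _) pi_quot_scale.
  rewrite -[0 in LHS](@pi_zeror _ _ _ _ _ (Quotient.quot (submod_zmod (submod_in N L)))).
  by rewrite -[LHS]Quotient.idealrBE subr0.
rewrite AssP //; split=> [[y]|[x Nx xP]].
  elim/quotW: y => x xP.
  by exists (val x) => [|b]; [apply: valP|rewrite xP piE].
by exists (\pi_(quotmod (submod_in N L)) (SubmodElt Nx))%qT => b; rewrite xP piE.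
Qed.

End Sub.

(** * The specialization order *)

Section Specialization.
Context (A : comNzRingType).

Lemma zariski_closure1 (p r : prime_idealr A) :
  zariski_closure [set p] r <-> {subset p <= r}.
Proof.
split=> [/(_ [set` p]) cl a pa|pr E /= pE a Ea]; last exact/pr/(pE p).
by apply: cl => // _ ->.
Qed.

Lemma subset_spec_prec (q p : prime_idealr A) :
  {subset q <= p} -> q <> p -> spec_prec q p.
Proof.
move=> qp neq; split=> [r /zariski_closure1 pr|cl].
  by apply/zariski_closure1 => a /qp/pr.
apply/neq/prime_idealr_inj => a; apply/idP/idP; first exact: qp.
by move: a; apply/zariski_closure1/cl/zariski_closure1.
Qed.

End Specialization.

(** * Well-orders *)

Section WellOrderTheory.
Context (T : Type) (R : rel T).
Hypothesis woR : well_order R.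

Let wo_min (P : set T) : P !=set0 -> exists2 z, P z & forall y, P y -> R z y.
Proof.
move=> [x Px]; have [|z [[/asboolP Pz zmin] _]] := woR (A := fun x => `[< P x >]).
  by exists x; apply/asboolP.
by exists z => // y Py; apply: zmin; apply/asboolP.
Qed.

Lemma wo_total x y : R x y \/ R y x.
Proof.
have [|z [->|->] zmin] := wo_min (P := [set x; y]); first by exists x; left.
  by left; apply: zmin; right.
by right; apply: zmin; left.
Qed.

Lemma wo_refl x : R x x.
Proof. by case: (wo_total x x). Qed.

Lemma wo_anti x y : R x y -> R y x -> x = y.
Proof.
move=> Rxy Ryx; have [|z [_ zuniq]] := woR (A := fun z => `[< z = x \/ z = y >]).
  by exists x; apply/asboolP; left.
have Hx : z = x.
  apply: zuniq; split=> [|t /asboolP[->|->]//]; last exact: wo_refl.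
  by apply/asboolP; left.
rewrite -Hx; apply: zuniq; split=> [|t /asboolP[->|->]//]; last exact: wo_refl.
by apply/asboolP; right.
Qed.

Lemma wo_trans x y z : R x y -> R y z -> R x z.
Proof.
move=> Rxy Ryz.
have [|t Pt tmin] := wo_min (P := [set x; y; z]); first by exists x; left; left.
have [Rtx Rty Rtz] : [/\ R t x, R t y & R t z].
  by split; apply: tmin; [left; left|left; right|right].
case: Pt => [[|]|] eqt; rewrite {}eqt // in Rtx Rty Rtz *.
  by rewrite (wo_anti Rxy Rtx).
by rewrite -(wo_anti Ryz Rty).
Qed.

Lemma strict_irrefl x : ~ strict R x x.
Proof. by case. Qed.

Lemma not_strict x y : ~ strict R x y <-> R y x.
Proof.
split=> [nxy|Ryx [Rxy neq]]; last exact/neq/wo_anti.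
have [Rxy|//] := wo_total x y.
by have [->|neq] := pselect (x = y); [apply: wo_refl|case: nxy].
Qed.

Lemma strict_wo_trans x y z : strict R x y -> R y z -> strict R x z.
Proof.
move=> [Rxy neq] Ryz; split; first exact: wo_trans Ryz.
by move=> eqxz; apply/neq/wo_anti => //; rewrite eqxz.
Qed.

Lemma wo_ind (P : T -> Prop) :
  (forall t, (forall s, strict R s t -> P s) -> P t) -> forall t, P t.
Proof.
move=> IH t; apply: contrapT => nPt.
have [|z nPz zmin] := wo_min (P := [set t | ~ P t]); first by exists t.
apply/nPz/IH => s sz; apply: contrapT => nPs.
by have /not_strict := zmin _ nPs.
Qed.

Lemma wo_least : inhabited T -> exists z, is_least R z.
Proof.
move=> [t]; have [|z _ zmin] := wo_min (P := setT); first by exists t.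
by exists z => y; apply: zmin.
Qed.

(** An element that is neither least nor a limit point has a predecessor with
    no element strictly in between, and that makes it the successor. *)
Lemma wo_trichotomy t :
  [\/ is_least R t, exists s, is_succ R s t | limit_point R t].
Proof.
have [[x xt]|nt] := pselect (exists x, strict R x t); last first.
  by constructor 1 => y; apply/not_strict => yt; apply: nt; exists y.
have [dense|] := pselect (forall x, strict R x t ->
    exists y, strict R x y /\ strict R y t).
  by constructor 3; split=> //; exists x.
move=> /existsNP[s /not_implyP[st gap]]; constructor 2; exists s; split=> // z sz.
by apply/not_strict => zt; apply: gap; exists z.
Qed.

End WellOrderTheory.

(** * The filtration by supports *)

Section Filtration.
Context (A : comNzRingType) (M : lmodType A) (R : rel (Ass M)).
Hypothesis nA : noetherian A.
Hypothesis woR : well_order R.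
Hypothesis Rprec :
  forall q p : Ass M, spec_prec (val q) (val p) -> strict R q p.

Lemma subset_wo (q p : Ass M) : {subset val q <= val p} -> R q p.
Proof.
move=> qp; have [eqqp|neq] := pselect (val q = val p).
  by rewrite (val_inj eqqp); apply: wo_refl.
by have [] := Rprec (subset_spec_prec qp neq).
Qed.

(** The elements of M whose support avoids every associated prime before t;
    this is the submodule M^t of the theorem. *)
Definition tail (t : Ass M) : {pred M} :=
  fun x => `[< forall q, strict R q t -> x \in local_kernel M (val q) >].

Lemma tailP t x :
  reflect (forall q, strict R q t -> x \in local_kernel M (val q)) (x \in tail t).
Proof. exact: asboolP. Qed.

Fact tail_closed t : submod_closed (tail t).
Proof.
split=> [|a x y /tailP xt /tailP yt]; apply/tailP => q qt.
  exact: (rpred0 (local_kernel M (val q))).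
apply: (rpredD (S := local_kernel M (val q))); last exact: yt.
exact/(rpredZ (s := local_kernel M (val q)))/xt.
Qed.
HB.instance Definition _ t :=
  GRing.isSubmodClosed.Build A M (tail t) (tail_closed t).

(** Say ann x = r. Then x dies in M_q exactly when r is not contained in q; no
    q < t contains r when t <= r, because inclusion implies the order, while
    q = r itself is an obstruction when r < t. *)
Lemma ann_tail (r t : Ass M) x : (forall b, (b \in val r) = (b *: x == 0)) ->
  (x \in tail t) <-> R t r.
Proof.
move=> xP; split=> [/tailP xt|Rtr].
  apply/(not_strict woR) => /xt/local_kernelP[w rw /eqP].
  by rewrite -xP (negPf rw).
apply/tailP => q qt; apply: contrapT => xq.
apply/(strict_irrefl (R := R) (x := q)).
apply: (strict_wo_trans woR) qt _; apply: (wo_trans woR) Rtr _.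
apply: subset_wo => b rb; apply: contrapT => /negP qb.
by apply: xq; apply/local_kernelP; exists b => //; apply/eqP; rewrite -xP.
Qed.

Lemma Ass_tail t :
  Ass (submod_type (tail t)) = [set val r | r in [set r | R t r]].
Proof.
apply/seteqP; split=> p; last first.
  move=> [r /= Rtr <-]; apply/Ass_submodP => //.
  have /set_mem/(AssP M nA)[x xP] := valP r.
  by exists x => //; apply/(ann_tail _ xP).
move=> /(Ass_submodP _ nA)[x xt xP].
have Mp : p \in Ass M by apply/mem_set/AssP => //; exists x.
by exists (SigSub Mp) => //=; apply/(@ann_tail (SigSub Mp) t x).
Qed.

Lemma tail_anti s t : R s t -> {subset tail t <= tail s}.
Proof.
move=> Rst x /tailP xt; apply/tailP => q qs; apply: xt.
exact: (strict_wo_trans woR) Rst.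
Qed.

Lemma tail_proper r s : strict R r s -> [set` tail s] `<` [set` tail r].
Proof.
move=> rs; split=> [|sub]; first exact: tail_anti rs.1.
have /set_mem/(AssP M nA)[x xP] := valP r.
have /sub : x \in tail r by apply/(ann_tail _ xP)/wo_refl.
by move=> /(ann_tail _ xP)/(not_strict woR).
Qed.

Lemma tail_least z : is_least R z -> tail z =i predT.
Proof.
by move=> zmin x; apply/tailP => q qz; have /(not_strict woR) := zmin q.
Qed.

Lemma tail_limit t : limit_point R t ->
  [set` tail t] = \bigcap_(r in [set r | strict R r t]) [set` tail r].
Proof.
move=> [_ dense]; apply/seteqP; split=> x /=.
  by move=> xt r [Rrt _]; apply: tail_anti xt.
move=> xr; apply/tailP => q /dense[r [qr rt]].
by have /tailP := xr r rt; apply.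
Qed.

Lemma tail_succE t t' x : is_succ R t t' ->
  (x \in tail t') <-> x \in tail t /\ x \in local_kernel M (val t).
Proof.
move=> [tt' t'min]; split=> [xt'|[/tailP xt xk]].
  by split; [apply: tail_anti xt'; case: tt'|move/tailP: xt'; apply].
apply/tailP => q qt'; have [->//|neq] := pselect (q = t).
apply: xt; split=> //; apply/(not_strict woR) => tq.
by have /(not_strict woR) := t'min _ tq.
Qed.

(** M^t / M^t' embeds into M_t, so an associated prime p is contained in t; it
    lifts to an associated prime of M^t, hence t <= p. Conversely, if ann x = t,
    then the image of x in M_t still has annihilator t, as t is prime. *)
Lemma Ass_tail_succ t t' : is_succ R t t' ->
  Ass (quotmod (submod_in (tail t) (tail t'))) = [set val t].
Proof.
move=> tt'; apply/seteqP; split=> p; last first.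
  move=> ->; apply/Ass_quotP => //.
  have /set_mem/(AssP M nA)[x xP] := valP t.
  have xt : x \in tail t by apply/(ann_tail _ xP)/wo_refl.
  exists x => // b; apply/idP/idP => [tb|/(tail_succE _ tt')].
    apply/(tail_succE _ tt'); have bx0 : b *: x = 0 by apply/eqP; rewrite -xP.
    by rewrite bx0 (rpred0 (tail t)) (rpred0 (local_kernel M (val t))).
  move=> [_ /local_kernelP[w tw /eqP]].
  by rewrite scalerA -xP prime_idealrM (negPf tw).
move=> /(Ass_quotP _ _ nA)[x xt xP].
have px b : b \in p <-> b *: x \in local_kernel M (val t).
  rewrite xP; split=> [/(tail_succE _ tt')[]//|bx].
  by apply/(tail_succE _ tt'); split=> //; apply: (rpredZ (s := tail t)).
have [w tw wxP] := lift_local_ann nA px.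
have Mp : p \in Ass M by apply/mem_set/AssP => //; exists (w *: x).
suff <- : SigSub Mp = t by [].
apply: (wo_anti woR); first exact/subset_wo/(ann_local_subset px).
by apply/(@ann_tail (SigSub Mp) t (w *: x)) => //; apply: (rpredZ (s := tail t)).
Qed.

(** An element of N that survives in M_q yields an associated prime of N inside
    q ([ann_below]), which precedes t together with q. *)
Lemma sub_tail (N : submodClosed M) t :
  Ass (submod_type N) `<=` [set val r | r in [set r | R t r]] ->
  {subset N <= tail t}.
Proof.
move=> AssN x Nx; apply/tailP => q qt; apply: contrapT => /negP.
move=> /(ann_below nA)[a [p pq axP]].
have /AssN[r /= Rtr rp] : Ass (submod_type N) p.
  by apply/Ass_submodP => //; exists (a *: x) => //; apply: (rpredZ (s := N)).
apply/(strict_irrefl (R := R) (x := q)).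
apply: (strict_wo_trans woR) qt _; apply: (wo_trans woR) Rtr _.
by apply: subset_wo => b rb; apply: pq; rewrite -[p]rp.
Qed.

(** Transfinite induction; at a successor t of s, an element x of the tail lies
    in F s by induction and is killed by some w outside s. Were x outside F t,
    a prime (F t : a x) would be associated to F s / F t, hence equal to s,
    and yet contain w. *)
Lemma tail_sub (F : Ass M -> submodClosed M) t :
  (forall t, is_least R t -> [set` F t] = setT) ->
  (forall t t', is_succ R t t' ->
     Ass (quotmod (submod_in (F t) (F t'))) = [set val t]) ->
  (forall t, limit_point R t ->
     [set` F t] = \bigcap_(r in [set r | strict R r t]) [set` F r]) ->
  {subset tail t <= F t}.
Proof.
move=> Fleast Fsucc Flim; elim/(wo_ind woR): t => t IHt x xt.
have [/Fleast Ft|[s st]|/Flim Ft] := wo_trichotomy woR t.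
- by have : [set` F t] x by rewrite Ft.
- have [s_t _] := st; move: (xt) => /(tail_succE _ st)[/(IHt _ s_t) Fsx].
  move=> /local_kernelP[w sw wx].
  apply: contrapT => /negP/(prime_colon nA)[a [p pP]].
  have : Ass (quotmod (submod_in (F s) (F t))) p.
    apply/Ass_quotP => //; exists (a *: x); last exact: pP.
    exact: (rpredZ (s := F s)).
  rewrite Fsucc // => ps; have : w \in p.
    by rewrite pP colonE scalerA mulrC -scalerA wx scaler0 (rpred0 (F t)).
  by rewrite ps (negPf sw).
- suff : [set` F t] x by [].
  by rewrite Ft => r rt; apply: IHt => //; apply: tail_anti xt; case: rt.
Qed.

End Filtration.

Theorem theorem1p1 (A : comNzRingType) (M : lmodType A) (R : rel (Ass M)) :
  noetherian A ->
  (exists x : M, x != 0) ->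
  well_order R ->
  (forall q p : Ass M, spec_prec (val q) (val p) -> strict R q p) ->
  exists! F : Ass M -> submodClosed M,
    [/\ (forall r s, strict R r s -> [set` F s] `<` [set` F r]),
        (exists2 z, is_least R z & [set` F z] = [set: M]),
        (forall t t', is_succ R t t' ->
           Ass (quotmod (submod_in (F t) (F t'))) = [set val t]),
        (forall t, limit_point R t ->
           [set` F t] = \bigcap_(r in [set r | strict R r t]) [set` F r]) &
        (forall t, Ass (submod_type (F t)) = [set val r | r in [set r | R t r]])].
Proof.
move=> nA [x x0] woR Rprec.
have inhAss : inhabited (Ass M).
  have /(prime_colon nA)[a [p pP]] : x \notin zero_submod M by [].
  suff Mp : p \in Ass M by split; exists p.
  by apply/mem_set/AssP => //; exists (a *: x) => b; rewrite pP.
exists (fun t => tail R t : submodClosed M); split.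
  split=> [r s|||t|t].
  - exact: tail_proper.
  - have [z zmin] := wo_least woR inhAss; exists z => //.
    by apply/seteqP; split=> // y _ /=; rewrite tail_least.
  - exact: Ass_tail_succ.
  - exact: tail_limit.
  - exact: Ass_tail.
move=> F [_ [z zmin Fz] Fsucc Flim FAss]; apply/funext => t.
apply: submodClosed_inj => y; apply/idP/idP; last first.
  by apply: sub_tail => //; rewrite FAss.
apply: tail_sub => // t' t'min.
by rewrite (wo_anti woR (t'min z) (zmin t')).
Qed.
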